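(* Let $n\ge 1$ be an integer, let $A$ be a complex number which is not a negative integer, and let $B_1,\dots,B_n$ be pairwise distinct complex numbers such that $\binom{A+n-1}{B_i-1}\neq 0$ for every $i$. Let $M$ be the $n\times n$ matrix \[ M=\left[\binom{A}{B_j-i}\right]_{i,j=1}^{n}. \] Then $M$ is invertible and, for all $1\le i,j\le n$, \[ [M^{-1}]_{i,j}=\binom{A+n-1}{B_i-1}^{-1}\sum_{k=1}^{j}\binom{A+n-1}{k-1}\binom{A-1+j-k}{j-k}(-1)^{k+j}\prod_{l=1,\,l\neq i}^{n}\frac{k-B_l}{B_i-B_l}. \]
   Context: Binomial coefficients with complex upper index $x$ are interpreted as follows: if $y$ is an integer, $\binom{x}{y}=\frac{x(x-1)\cdots(x-y+1)}{y!}$ for $y\ge 0$ and $\binom{x}{y}=0$ for $y<0$; if $y$ is not an integer (and $x$ is not a negative integer), $\binom{x}{y}=\frac{\Gamma(x+1)}{\Gamma(y+1)\Gamma(x-y+1)}$. In particular, when $A$ and all $B_j$ are integers these are the usual binomial coefficients. *)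

(* Defs.v *)
From mathcomp Require Import all_boot all_order all_algebra.
From mathcomp Require Import all_classical all_reals all_analysis.
From mathcomp Require Export complex.
Set Implicit Arguments.
Unset Strict Implicit.
Unset Printing Implicit Defensive.
Import Order.TTheory GRing.Theory Num.Theory.
Import numFieldNormedType.Exports.
Local Open Scope classical_set_scope.
Local Open Scope ring_scope.
Local Open Scope complex_scope.

(* n ^ z = exp (z ln n), for n > 0. *)
Definition natpowC (R : realType) (n : nat) (z : R[i]) : R[i] :=
  (expR (complex.Re z * ln n%:R))%:C *
  (cos (complex.Im z * ln n%:R) +i* sin (complex.Im z * ln n%:R)).

(* Euler's definition of the Gamma function,
   Gamma z = lim_n n! n^z / (z (z + 1) ... (z + n)).
   At a pole z = - m the denominators vanish for n >= m, so with the convention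
   x / 0 = 0 the sequence is eventually 0 and (Gamma z)^-1 = 0, which is the
   value at z of the entire function 1 / Gamma. *)
Definition Gamma (R : realType) (z : R[i]) : R[i] :=
  lim ((fun n : nat =>
    n`!%:R * natpowC n z / \prod_(k < n.+1) (z + k%:R) : R[i]^o) @ \oo).

(* y is an integer if and only if it is equal to the floor of its real part.
   For y not an integer, x is meant not to be a negative integer; when x - y is
   a negative integer, 1 / Gamma (x - y + 1) = 0 and the coefficient is 0. *)
Definition binomC (R : realType) (x y : R[i]) : R[i] :=
  let m := Num.floor (complex.Re y) in
  if y == m%:~R then
    match m with
    | Posz p => (\prod_(k < p) (x - k%:R)) / p`!%:R
    | Negz _ => 0
    end
  else Gamma (x + 1) / (Gamma (y + 1) * Gamma (x - y + 1)).

(* Main.v *)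
(** The relation [(Gamma z)^-1 = z / Gamma (z + 1)] gives, for all [y] and all
    [x != 0], [x binom(x-1, y) = (x - y) binom(x, y)] and
    [x binom(x-1, y-1) = y binom(x, y)].  Iterating them from [x = A + n - 1]
    gives [x (x-1) ... (A+1) binom(A, y-i) = q_i(y) binom(x, y-1)] with
    [q_i(y) = (y-1) ... (y-i+1) (x+1-y) ... (A+i+1-y)], a polynomial of degree
    [n - 1].  So the columns of [M] are values of the [q_i] at the nodes [B_j],
    up to nonzero factors, and Lagrange interpolation gives a matrix whose
    product with [M] on the right has the nodes [1, ..., n] instead.  At these
    nodes [M] is the triangular Toeplitz matrix [binom(A, j-i)], and
    Vandermonde's convolution says that its inverse is [binom(-A, j-i)]. *)
Require Import Defs.
From mathcomp Require Import all_boot all_order all_algebra.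
From mathcomp Require Import all_classical all_reals all_analysis.
From mathcomp Require Import ring.
Import Order.TTheory GRing.Theory Num.Theory.
Import numFieldNormedType.Exports.
Local Open Scope classical_set_scope.
Local Open Scope ring_scope.

Set Implicit Arguments.
Unset Strict Implicit.
Unset Printing Implicit Defensive.

Definition ffactr (R : pzRingType) (x : R) n : R := \prod_(k < n) (x - k%:R).

Local Notation "x ^_ n" := (ffactr x n) : ring_scope.

Section FallingFactorial.
Variable R : pzRingType.
Implicit Type x : R.

Lemma ffactr0 x : x ^_ 0 = 1.
Proof. exact: big_ord0. Qed.

Lemma ffactrSr x n : x ^_ n.+1 = x ^_ n * (x - n%:R).
Proof. exact: big_ord_recr. Qed.

Lemma ffactrD x m n : x ^_ (m + n) = x ^_ m * (x - m%:R) ^_ n.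
Proof.
rewrite /ffactr big_split_ord; congr (_ * _).
by apply: eq_bigr => k _; rewrite natrD opprD addrA.
Qed.

Lemma ffactrS x n : x ^_ n.+1 = x * (x - 1) ^_ n.
Proof. by rewrite -add1n ffactrD ffactrSr ffactr0 mul1r subr0. Qed.

Lemma ffactr0n n : (0 : R) ^_ n = (n == 0)%:R.
Proof. by case: n => [|n]; rewrite (ffactr0, ffactrS) ?mul0r. Qed.

End FallingFactorial.

Lemma ffactr_neq0 (R : idomainType) (x : R) n :
  (forall k, (k < n)%N -> x != k%:R) -> x ^_ n != 0.
Proof. by move=> xN; apply/prodf_neq0 => k _; rewrite subr_eq0 xN. Qed.

Lemma ffactr_oppr (R : comPzRingType) (x : R) n :
  (- x) ^_ n = (-1) ^+ n * (x - 1 + n%:R) ^_ n.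
Proof.
rewrite /ffactr (reindex_inj rev_ord_inj) /= -[in (-1) ^+ n](card_ord n).
by rewrite -prodrN; apply: eq_bigr => k _; rewrite natrB // -natr1; ring.
Qed.

Lemma horner_ffactr (R : comNzRingType) (p : {poly R}) n x :
  (p ^_ n).[x] = p.[x] ^_ n.
Proof.
by rewrite horner_prod; apply: eq_bigr => k _; rewrite -polyC_natr !hornerE.
Qed.

Lemma size_ffactr (R : nzRingType) (p : {poly R}) n :
  (size p <= 2)%N -> (size (p ^_ n)%R <= n.+1)%N.
Proof.
move=> sp; elim: n => [|n IHn]; first by rewrite ffactr0 size_poly1.
have spn : (size (p - n%:R)%R <= 2)%N.
  rewrite (leq_trans (size_polyD _ _)) // geq_max sp size_polyN -polyC_natr.
  by rewrite (leq_trans (size_polyC_leq1 _)).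
rewrite ffactrSr (leq_trans (size_polyMleq _ _)) // -subn1 leq_subLR.
by rewrite (leq_trans (leq_add IHn spn)) // addn2.
Qed.

Section GeneralizedBinomial.
Variable F : numFieldType.
Implicit Types x y : F.

Definition binr x n : F := x ^_ n / n`!%:R.

Lemma binr0 x : binr x 0 = 1.
Proof. by rewrite /binr ffactr0 divr1. Qed.

Lemma binr0n n : binr 0 n = (n == 0)%:R.
Proof. by case: n => [|n]; rewrite ?binr0 // /binr ffactr0n mul0r. Qed.

Lemma binr_oppr x n : binr (- x) n = (-1) ^+ n * binr (x - 1 + n%:R) n.
Proof. by rewrite /binr ffactr_oppr mulrA. Qed.

Lemma mul_binr_down x n : x * binr (x - 1) n = (x - n%:R) * binr x n.
Proof. by rewrite /binr !mulrA -ffactrS ffactrSr [_ * x ^_ n]mulrC. Qed.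

Lemma mul_binr_diag x n : x * binr (x - 1) n = n.+1%:R * binr x n.+1.
Proof.
by rewrite /binr mulrA -ffactrS factS natrM invfM [RHS]mulrCA mulVKf.
Qed.

Lemma mul_binr_left x n : n.+1%:R * binr x n.+1 = (x - n%:R) * binr x n.
Proof. by rewrite -mul_binr_diag mul_binr_down. Qed.

Lemma Vandermonde_binr x y n :
  \sum_(k < n.+1) binr x k * binr y (n - k) = binr (x + y) n.
Proof.
elim: n => [|n IHn]; first by rewrite big_ord1 subnn !binr0 mulr1.
have n1_neq0 : n.+1%:R != 0 :> F by rewrite pnatr_eq0.
apply: (mulfI n1_neq0); rewrite mul_binr_left -IHn !mulr_sumr.
transitivity (\sum_(k < n.+2) k%:R * binr x k * binr y (n.+1 - k) +
    \sum_(k < n.+2) binr x k * ((n.+1 - k)%:R * binr y (n.+1 - k))).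
  rewrite -big_split /=; apply: eq_bigr => k _.
  by rewrite natrB -1?ltnS //; ring.
rewrite big_ord_recl !mul0r add0r.
rewrite [X in _ + X]big_ord_recr /= subnn mul0r mulr0 addr0 -big_split /=.
apply: eq_bigr => k _; have kn : (k <= n)%N by rewrite -ltnS.
rewrite /bump /= add1n subSS mul_binr_left subSn // mul_binr_left natrB //.
by ring.
Qed.

Definition binr_mx n x : 'M[F]_n :=
  \matrix_(i, j) (binr x (j - i) *+ (i <= j)).

Lemma binr_mx0 n : binr_mx n 0 = 1%:M.
Proof.
apply/matrixP => i j.
by rewrite !mxE binr0n subn_eq0 -mulrnA mulnb andbC -eqn_leq.
Qed.

Lemma binr_mxM n x y : binr_mx n x *m binr_mx n y = binr_mx n (x + y).
Proof.
apply/matrixP => i j; rewrite !mxE.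
pose f k := binr x (k - i) * binr y (j - k).
transitivity (\sum_(i <= k < j.+1) f k).
  rewrite big_geq_mkord /= (big_ord_widen_cond n (leq i) f) // [RHS]big_mkcond.
  apply: eq_bigr => k _.
  by rewrite !mxE mulrnAl mulrnAr -mulrnA mulnb mulrb andbC.
have [ij|ji] := leqP i j; last by rewrite big_geq.
rewrite -{1}(add0n i) big_addn subSn // big_mkord -Vandermonde_binr.
by apply: eq_bigr => k _; rewrite /f addnK addnC subnDA.
Qed.

End GeneralizedBinomial.

Section LagrangeInterpolation.
Variables (F : fieldType) (I : finType) (b : I -> F).
Hypothesis b_inj : injective b.

(* The Lagrange basis of [qpoly] asks for nodes that extend to an injection of
   [nat] into [F], hence for an infinite field. *)
Definition lagrange_poly i : {poly F} :=
  \prod_(j | j != i) ((b i - b j)^-1 *: ('X - (b j)%:P)).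

Lemma horner_lagrange_poly i x :
  (lagrange_poly i).[x] = \prod_(j | j != i) ((x - b j) / (b i - b j)).
Proof.
by rewrite horner_prod; apply: eq_bigr => j _; rewrite !hornerE mulrC.
Qed.

Lemma lagrange_poly_node i j : (lagrange_poly i).[b j] = (i == j)%:R.
Proof.
rewrite horner_lagrange_poly; have [<-|ij] := eqVneq i j.
  by rewrite big1 // => k ki; rewrite divff // subr_eq0 (inj_eq b_inj) eq_sym.
by rewrite (bigD1 j) 1?eq_sym //= subrr !mul0r.
Qed.

Lemma size_lagrange_poly i : (size (lagrange_poly i) <= #|I|)%N.
Proof.
rewrite /lagrange_poly scaler_prod (leq_trans (size_scale_leq _ _)) //.
rewrite -(big_enum _ _ (predC1 i)) size_prod_XsubC -cardE cardC1 prednK //.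
by apply/card_gt0P; exists i.
Qed.

Lemma lagrange_interpolation (p : {poly F}) : (size p <= #|I|)%N ->
  p = \sum_i p.[b i] *: lagrange_poly i.
Proof.
move=> sp; apply/eqP; rewrite -subr_eq0; apply/eqP.
apply: (@roots_geq_poly_eq0 _ _ [seq b i | i <- enum I]).
- apply/allP => _ /mapP[i _ ->]; rewrite rootE !hornerE horner_sum.
  rewrite (bigD1 i) //= big1 => [|j ji].
    by rewrite hornerZ lagrange_poly_node eqxx mulr1 addr0 subrr.
  by rewrite hornerZ lagrange_poly_node (negPf ji) mulr0.
- by rewrite map_inj_uniq ?enum_uniq.
rewrite size_map -cardE (leq_trans (size_polyD _ _)) // size_polyN geq_max sp.
apply: leq_trans (size_sum _ _ _) _; apply/bigmax_leqP => i _.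
exact: leq_trans (size_scale_leq _ _) (size_lagrange_poly i).
Qed.

End LagrangeInterpolation.

Section FilterLimits.
Context {T : Type} {F : set_system T} {FF : ProperFilter F}.

Lemma near_eq_lim {U : pnbhsType} (f g : T -> U) :
  (\forall x \near F, f x = g x) -> lim (f @ F) = lim (g @ F).
Proof.
move=> fg; congr (lim _); apply/seteqP; split; apply: near_eq_cvg => //.
by near do apply/esym.
Unshelve. all: by end_near. Qed.

(* Nothing is assumed of [u]: if it diverges then so does [c \* u], and both
   limits are the default value 0. *)
Lemma limM_neq0 {K : numFieldType} (c u : T -> K) (l : K) :
  l != 0 -> c @ F --> l -> lim (c \* u @ F) = l * lim (u @ F).
Proof.
move=> l_neq0 cl; have [cu|dvu] := pselect (cvg (u @ F)).
  by apply: (@norm_cvg_lim K K); exact: cvgM.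
rewrite (dvgP dvu) -[point]/(0 : K) mulr0; apply: dvgP => cv; apply: dvu.
have c_neq0 : \forall x \near F, c x != 0 by exact: cvgr_neq0 cl l_neq0.
apply: (cvgP (l^-1 * lim (c \* u @ F))).
apply: cvg_trans (near_eq_cvg _) (cvgM (cvgV l_neq0 cl) cv).
by near=> x; rewrite /= mulKf ?(near c_neq0 x).
Unshelve. all: by end_near. Qed.

End FilterLimits.

Section EulerGamma.
Variable R : realType.
Implicit Types z : R[i].

Lemma continuous_real_complex : continuous (real_complex R : R -> R[i]^o).
Proof.
move=> x; apply/cvgrPdist_le => e e_gt0.
have eE : e = (complex.Re e)%:C%C by rewrite RRe_real // gtr0_real.
have re_gt0 : 0 < complex.Re e by move: e_gt0; rewrite ltcE => /andP[].
near=> y; rewrite -rmorphB eE normc_def /= expr0n addr0 sqrtr_sqr lecR.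
by near: y; exact: cvgr_dist_le.
Unshelve. all: by end_near. Qed.

Lemma cvg_natrV_complex : n%:R^-1 @[n --> \oo] --> (0 : R[i]^o).
Proof.
rewrite (_ : (fun n => _) = real_complex R \o (fun n => n%:R^-1)); last first.
  by apply/funext => n /=; rewrite fmorphV rmorph_nat.
apply: cvg_comp; last exact: continuous_real_complex.
by apply/gtr0_cvgV0; [exists 1%N => // n /=; rewrite ltr0n|exact: cvgr_idn].
Qed.

Lemma cvg_natr_divD (a : R[i]^o) :
  n%:R / (a + n%:R) @[n --> \oo] --> (1 : R[i]^o).
Proof.
have cvg_one_addV : 1 + a * n%:R^-1 @[n --> \oo] --> (1 : R[i]^o).
  rewrite -[X in _ --> X]addr0 -[X in _ --> _ + X](mulr0 a).
  by apply: cvgD; [exact: cvg_cst|apply: cvgMl_tmp; exact: cvg_natrV_complex].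
rewrite -[X in _ --> X]invr1.
apply: cvg_trans (near_eq_cvg _) (cvgV (oner_neq0 _) cvg_one_addV).
near=> n; have n_neq0 : n%:R != 0 :> R[i].
  by rewrite pnatr_eq0 -lt0n; near: n; exists 1%N.
by rewrite /= -[RHS]invf_div mulrDl divff // addrC.
Unshelve. all: by end_near. Qed.

Lemma natpowCD1 n z : (0 < n)%N -> natpowC n (z + 1) = n%:R * natpowC n z.
Proof.
case: z => a b n_gt0; rewrite /natpowC /= addr0 mulrDl mul1r expRD.
by rewrite lnK ?posrE ?ltr0n // rmorphM rmorph_nat; ring.
Qed.

Definition Gamma_seq z n : R[i] :=
  n`!%:R * natpowC n z / \prod_(k < n.+1) (z + k%:R).

(* Where [z + 1 + n = 0] both sides are 0, by the convention [x / 0 = 0]. *)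
Lemma Gamma_seqD1 z n : z != 0 -> (0 < n)%N ->
  Gamma_seq (z + 1) n = z * (n%:R / (z + 1 + n%:R)) * Gamma_seq z n.
Proof.
move=> z_neq0 n_gt0; rewrite /Gamma_seq natpowCD1 //.
have -> : \prod_(k < n.+1) (z + k%:R) = z * \prod_(k < n) (z + 1 + k%:R).
  rewrite big_ord_recl addr0; congr (_ * _).
  by apply: eq_bigr => k _; rewrite -addrA nat1r.
rewrite big_ord_recr !invfM /=; move: (_^-1) (\prod_(_ < _) _)^-1 => q p.
by field.
Qed.

Lemma GammaD1 z : z != 0 -> Gamma (z + 1) = z * Gamma z.
Proof.
move=> z_neq0; pose K : numFieldType := R[i].
pose c n : K := z * (n%:R / (z + 1 + n%:R)).
have cz : c @ \oo --> (z : K).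
  rewrite -[X in _ --> X]mulr1.
  by apply: cvgMl_tmp; exact: cvg_natr_divD.
rewrite -[RHS](limM_neq0 _ z_neq0 cz).
apply: (@near_eq_lim _ _ _ K (Gamma_seq (z + 1)) (c \* Gamma_seq z)).
by exists 1%N => // n /= n_gt0; exact: Gamma_seqD1.
Qed.

Lemma Gamma0 : Gamma (0 : R[i]) = 0.
Proof.
pose K : numFieldType := R[i].
apply: (@norm_lim_near_cst K K); apply: nearW => n.
by rewrite big_ord_recl add0r mul0r invr0 mulr0.
Qed.

(* Unlike [GammaD1], this includes [z = 0], because [Gamma 0 = 0]. *)
Lemma invr_Gamma z : (Gamma z)^-1 = z / Gamma (z + 1).
Proof.
have [->|z_neq0] := eqVneq z 0; first by rewrite Gamma0 invr0 mul0r.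
by rewrite GammaD1 // invfM mulVKf.
Qed.

End EulerGamma.

Section ComplexBinomial.
Variable R : realType.
Implicit Types x y : R[i].

Lemma binomC_int x (m : int) :
  binomC x m%:~R = if m is Posz p then binr x p else 0.
Proof.
rewrite /binomC (_ : complex.Re m%:~R = m%:~R) ?intrKfloor ?eqxx //.
by rewrite -(rmorph_int (real_complex R)).
Qed.

Lemma binomC_nat x n : binomC x n%:R = binr x n.
Proof. by rewrite pmulrn binomC_int. Qed.

Lemma binomC_natB x m n : binomC x (m%:R - n%:R) = binr x (m - n) *+ (n <= m).
Proof.
case: leqP => [nm|mn]; first by rewrite -natrB // binomC_nat.
have -> : m%:R - n%:R = (Negz (n - m).-1)%:~R :> R[i].
  by rewrite NegzE prednK ?subn_gt0 // rmorphN /= -pmulrn natrB ?opprB // ltnW.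
by rewrite binomC_int.
Qed.

Lemma binomC_nonint x y : ~ (exists m : int, y = m%:~R) ->
  binomC x y = Gamma (x + 1) / (Gamma (y + 1) * Gamma (x - y + 1)).
Proof.
move=> yN; rewrite /binomC ifF //; apply/eqP => yE; apply: yN.
by exists (Num.floor (complex.Re y)).
Qed.

Lemma mul_binomC_down x y :
  x != 0 -> x * binomC (x - 1) y = (x - y) * binomC x y.
Proof.
move=> x_neq0; have [[m ->]|yN] := pselect (exists m : int, y = m%:~R).
  by rewrite !binomC_int; case: m => p; rewrite ?mulr0 -?pmulrn ?mul_binr_down.
rewrite !binomC_nonint // subrK (GammaD1 x_neq0) !invfM.
rewrite (_ : x - 1 - y + 1 = x - y); last by ring.
by rewrite (invr_Gamma (x - y)); ring.
Qed.

Lemma mul_binomC_diag x y :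
  x != 0 -> x * binomC (x - 1) (y - 1) = y * binomC x y.
Proof.
move=> x_neq0; have [[m ->]|yN] := pselect (exists m : int, y = m%:~R).
  rewrite -[X in _%:~R - X]/(1%:~R) -rmorphB !binomC_int.
  case: m => [[|p]|p]; rewrite /= ?mul0r ?mulr0 //.
  by rewrite subn1 mul_binr_diag.
have y_neq0 : y != 0 by apply/eqP => y0; apply: yN; exists 0.
have y1N : ~ exists m : int, y - 1 = m%:~R.
  by move=> [m ym]; apply: yN; exists (m + 1); rewrite rmorphD /= -ym subrK.
rewrite !binomC_nonint // !subrK (GammaD1 x_neq0) (GammaD1 y_neq0) !invfM.
rewrite (_ : x - 1 - (y - 1) = x - y); last by ring.
by move: (Gamma y)^-1 (Gamma (x - y + 1))^-1 => P Q; field.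
Qed.

Lemma mul_ffactr_binomC_down x y n : x ^_ n != 0 ->
  x ^_ n * binomC (x - n%:R) y = (x - y) ^_ n * binomC x y.
Proof.
elim: n => [|n IHn]; first by rewrite !ffactr0 subr0.
rewrite !ffactrSr mulf_eq0 negb_or => /andP[/IHn IH xn_neq0].
rewrite -natr1 opprD addrA -mulrA mul_binomC_down // mulrCA IH.
by rewrite mulrA; congr (_ * _); ring.
Qed.

Lemma mul_ffactr_binomC_diag x y n : x ^_ n != 0 ->
  x ^_ n * binomC (x - n%:R) (y - n%:R) = y ^_ n * binomC x y.
Proof.
elim: n => [|n IHn]; first by rewrite !ffactr0 !subr0.
rewrite !ffactrSr mulf_eq0 negb_or => /andP[/IHn IH xn_neq0].
rewrite -natr1 !opprD !addrA -mulrA mul_binomC_diag // mulrCA IH.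
by ring.
Qed.

Lemma mul_ffactr_binomC x y m n : x ^_ (m + n) != 0 ->
  x ^_ (m + n) * binomC (x - (m + n)%:R) (y - m%:R) =
  y ^_ m * (x - y) ^_ n * binomC x y.
Proof.
rewrite ffactrD mulf_eq0 negb_or => /andP[xm_neq0 xn_neq0].
rewrite natrD opprD addrA -mulrA mul_ffactr_binomC_down // mulrCA.
rewrite mul_ffactr_binomC_diag // (_ : x - m%:R - (y - m%:R) = x - y); ring.
Qed.

Definition binom_mx n x (b : 'I_n -> R[i]) : 'M[R[i]]_n :=
  \matrix_(i, j) binomC x (b j - i.+1%:R).

Lemma binom_mx_nat n x : binom_mx x (fun j : 'I_n => j.+1%:R) = binr_mx n x.
Proof. by apply/matrixP => i j; rewrite !mxE binomC_natB subSS. Qed.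

Definition binom_poly n x i : {poly R[i]} :=
  ('X - 1) ^_ i * ((x + 1)%:P - 'X) ^_ (n - i).

Lemma size_binom_poly n x i : (i <= n)%N -> (size (binom_poly n x i) <= n.+1)%N.
Proof.
move=> i_le_n; rewrite (leq_trans (size_polyMleq _ _)) // -subn1 leq_subLR.
have size_lower : (size (('X - 1 : {poly R[i]}) ^_ i)%R <= i.+1)%N.
  by rewrite size_ffactr // size_XsubC.
have size_upper : (size (((x + 1)%:P - 'X) ^_ (n - i))%R <= (n - i).+1)%N.
  by rewrite size_ffactr // -opprB size_polyN size_XsubC.
by rewrite (leq_trans (leq_add size_lower size_upper)) // addSn addnS subnKC.
Qed.

Lemma horner_binom_poly n x i y : (i <= n)%N -> x ^_ n != 0 ->
  (binom_poly n x i).[y] * binomC x (y - 1) =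
  x ^_ n * binomC (x - n%:R) (y - i.+1%:R).
Proof.
move=> i_le_n x_neq0; have := @mul_ffactr_binomC x (y - 1) i (n - i).
rewrite subnKC // -addrA -opprD nat1r => -> //.
rewrite hornerM !horner_ffactr !hornerE.
by congr (_ * _ ^_ _ * _); ring.
Qed.

(* The factors [binomC] cancel those that [horner_binom_poly] puts on the
   columns of [binom_mx]; what remains is interpolation from [b] to [c]. *)
Definition node_change_mx n x (b c : 'I_n -> R[i]) : 'M[R[i]]_n :=
  \matrix_(i, j) ((binomC x (b i - 1))^-1 * (lagrange_poly b i).[c j] *
                  binomC x (c j - 1)).

Lemma mul_binom_node_change_mx n x (b c : 'I_n.+1 -> R[i]) :
    x ^_ n != 0 -> injective b -> (forall i, binomC x (b i - 1) != 0) ->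
  binom_mx (x - n%:R) b *m node_change_mx x b c = binom_mx (x - n%:R) c.
Proof.
move=> xn_neq0 b_inj bN; apply/matrixP => i j; rewrite !mxE.
have i_le_n : (i <= n)%N by rewrite -ltnS.
apply: (mulfI xn_neq0); rewrite mulr_sumr -horner_binom_poly //.
rewrite [in RHS](@lagrange_interpolation _ _ _ b_inj (binom_poly n x i)).
  rewrite horner_sum mulr_suml; apply: eq_bigr => l _.
  by rewrite !mxE mulrA -horner_binom_poly // hornerZ !mulrA mulfK.
by rewrite card_ord size_binom_poly.
Qed.

Lemma binr_oppr_binomC x m n : (m <= n)%N ->
  binr (- x) (n - m) =
  binomC (x - 1 + n%:R - m%:R) (n%:R - m%:R) * (-1) ^+ (m + n).
Proof.
move=> mn; rewrite binomC_natB mn mulr1n -addrA -natrB // binr_oppr mulrC.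
by rewrite -[in RHS]signr_odd addnC oddD -oddB // signr_odd.
Qed.

Definition inv_binom_mx n x (b : 'I_n.+1 -> R[i]) : 'M[R[i]]_n.+1 :=
  node_change_mx (x + n%:R) b (fun k : 'I_n.+1 => k.+1%:R) *m
  binr_mx n.+1 (- x).

Lemma mul_binom_inv_mx n x (b : 'I_n.+1 -> R[i]) :
    (x + n%:R) ^_ n != 0 -> injective b ->
    (forall i, binomC (x + n%:R) (b i - 1) != 0) ->
  binom_mx x b *m inv_binom_mx x b = 1%:M.
Proof.
move=> xn_neq0 b_inj bN; rewrite mulmxA -{1}(addrK n%:R x).
rewrite mul_binom_node_change_mx // addrK binom_mx_nat.
by rewrite binr_mxM subrr binr_mx0.
Qed.

Lemma inv_binom_mxE n x (b : 'I_n.+1 -> R[i]) i j :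
  inv_binom_mx x b i j =
  (binomC (x + n%:R) (b i - 1))^-1 *
  \sum_(1 <= k < j.+2)
    binomC (x + n%:R) (k%:R - 1) *
    binomC (x - 1 + j.+1%:R - k%:R) (j.+1%:R - k%:R) *
    (-1) ^+ (k + j.+1) *
    \prod_(l < n.+1 | l != i) ((k%:R - b l) / (b i - b l)).
Proof.
rewrite !mxE big_add1 (big_nat_widen _ _ n.+1) ?ltn_ord //.
rewrite big_mkord [in RHS]big_mkcond.
rewrite mulr_sumr; apply: eq_bigr => k _; rewrite !mxE /= ltnS.
case: leqP => [kj|_]; last by rewrite !mulr0.
rewrite mulr1n -subSS binr_oppr_binomC // horner_lagrange_poly.
by ring.
Qed.

End ComplexBinomial.

Theorem theorem1 (R : realType) (n : nat) (A : R[i]) (B : 'I_n -> R[i])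
    (hn : (1 <= n)%N)
    (hA : forall m : nat, A <> - m.+1%:R)
    (hB : injective B)
    (hAB : forall i : 'I_n, binomC (A + n%:R - 1) (B i - 1) <> 0) :
  let M : 'M[R[i]]_n :=
    \matrix_(i < n, j < n) binomC A (B j - i.+1%:R) in
  M \in unitmx /\
  forall i j : 'I_n,
    invmx M i j =
    (binomC (A + n%:R - 1) (B i - 1))^-1 *
    \sum_(1 <= k < j.+2)
      binomC (A + n%:R - 1) (k%:R - 1) *
      binomC (A - 1 + j.+1%:R - k%:R) (j.+1%:R - k%:R) *
      (-1) ^+ (k + j.+1) *
      \prod_(l < n | l != i) ((k%:R - B l) / (B i - B l)).
Proof.
case: n B hn hB hAB => // n B _ B_inj; rewrite -natr1 addrA addrK => BN M.
have An_neq0 : (A + n%:R) ^_ n != 0.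
  apply: ffactr_neq0 => k kn; apply/eqP => Ak; apply: (hA (n - k).-1).
  by rewrite prednK ?subn_gt0 // natrB 1?ltnW // opprB -Ak addrK.
have MN : M *m inv_binom_mx A B = 1%:M.
  by apply: mul_binom_inv_mx => // i; apply/eqP.
have [M_unit _] := mulmx1_unit MN; split=> // i j.
by rewrite -inv_binom_mxE -[invmx M]mulmx1 -MN mulKmx.
Qed.
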